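(* Let $X$ be an arcwise connected metric space with at least three points and with $\dim_1(X) = 1$. Then $X$ is a Jordan arc, that is, $X$ is homeomorphic to one of the real intervals $[0,1]$ and $[0,+\infty)$.
   Context: A subset $S$ of a metric space $(X,d)$ is a ($1$-)metric generator for $X$ if for any two distinct points $u,v\in X$ there is $w\in S$ with $d(u,w)\neq d(v,w)$. $\dim_1(X)$ is the infimum of $|S|$ over all $1$-metric generators $S$ for $X$, where $|S|$ is the number of elements if $S$ is finite and $|S|=+\infty$ if $S$ is infinite. Arcwise connected means that any two points $x,y\in X$ are joined by a continuous curve $\gamma:[0,1]\to X$ with $\gamma(0)=x$, $\gamma(1)=y$. *)

(* Defs.v *)
From HB Require Import structures.
From mathcomp Require Import all_boot all_order all_algebra.
From mathcomp Require Import all_classical all_reals all_analysis.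

Set Implicit Arguments.
Unset Strict Implicit.
Unset Printing Implicit Defensive.

Import Order.TTheory GRing.Theory Num.Theory.
Import numFieldTopology.Exports numFieldNormedType.Exports.

Local Open Scope classical_set_scope.
Local Open Scope ring_scope.

Definition metric_generator (R : realType) (X : metricType R) (S : set X) : Prop :=
  forall u v : X, u <> v -> exists2 w, S w & mdist u w <> mdist v w.

(* [counting S] is the number of elements of [S], and +oo if [S] is infinite. *)
Definition dim1 (R : realType) (X : metricType R) : \bar R :=
  ereal_inf [set counting S | S in @metric_generator R X].

Definition arcwise_connected (R : realType) (X : topologicalType) : Prop :=
  forall x y : X, exists gamma : R -> X,
    [/\ {within `[0, 1], continuous gamma}, gamma 0 = x & gamma 1 = y].

Definition homeomorphic (X Y : topologicalType) : Prop :=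
  exists (f : X -> Y) (g : Y -> X),
    [/\ cancel f g, cancel g f, continuous f & continuous g].

(* The intervals are coerced to types, carrying the topology induced by [R]. *)
Definition Jordan_arc (R : realType) (X : topologicalType) : Prop :=
  homeomorphic X (set_type (`[0, 1]%classic : set R))
  \/ homeomorphic X (set_type (`[0, +oo[%classic : set R)).

(* Main.v *)
Require Import Defs.
From mathcomp Require Import all_boot all_order all_algebra.
From mathcomp Require Import all_classical all_reals all_analysis.
From mathcomp Require Import finmap ring lra.

(** Distance to the single point of a metric basis is an injective continuous
    real function with minimum 0.  Its range is an interval by the intermediate
    value theorem.  Its inverse is continuous since each initial segment of the
    range is covered by the compact image of one arc, on which a continuous
    injection into the line is closed.  The range is [0, M], [0, M) or
    [0, +oo); the maps t / M and t / (M - t) normalize the first two. *)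

Import Order.TTheory GRing.Theory Num.Theory.
Import numFieldTopology.Exports numFieldNormedType.Exports.

Local Open Scope classical_set_scope.
Local Open Scope ring_scope.

Lemma arc_IVT (R : realType) (X : topologicalType) (F : X -> R) (gamma : R -> X)
    (v : R) :
  {within `[0, 1], continuous gamma} -> continuous F ->
  F (gamma 0) <= v <= F (gamma 1) ->
  exists2 c : R, c \in `[0, 1] & F (gamma c) = v.
Proof.
move=> gammaC FC /andP[v0 v1].
have [] := @IVT R (F \o gamma) 0 1 v ler01.
- by move=> t; exact: (cvg_comp _ _ (gammaC t) (FC _)).
- by rewrite ge_min v0/= le_max v1 orbT.
- by move=> c c01 <-; exists c.
Qed.

(** This is continuity of the inverse of [F] at [F x], phrased without choosing an inverse; [t] may
    lie outside the range. *)
Lemma arcwise_connected_inverse_near (R : realType) (X : topologicalType)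
    (F : X -> R) (a : X) :
  arcwise_connected R X -> continuous F -> injective F ->
  (forall y, F a <= F y) ->
  forall (x : X) (U : set X), nbhs x U ->
  \forall t \near F x, forall y, F y = t -> U y.
Proof.
move=> hX FC Finj Fmin x U xU.
(* If some value exceeds [F x], its point serves as [z]; otherwise [F x] is the maximum and [z = x]
   works. *)
have [z Hz] : exists z, \forall t \near F x, forall y, F y = t -> t <= F z.
  have [[z xz]|hmax] := pselect (exists z, F x < F z).
    exists z; near=> t => y _; apply/ltW; near: t.
    exact: lt_nbhsl.
  exists x; near=> t => y <-; rewrite leNgt; apply/negP => xy.
  by apply: hmax; exists y.
have [gamma [gammaC g0 g1]] := hX a z.
(* [K] holds the values on the arc outside the interior of [U]. Removing an open set keeps the arc
   compact, so [K] is closed, and injectivity keeps [F x] out of it. *)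
pose K := F @` ((gamma @` `[0, 1]) `&` ~` U^°).
have Kclosed : closed K.
  apply: compact_closed; first exact: Rhausdorff.
  apply: continuous_compact; first exact: continuous_subspaceT.
  apply: compact_closedI.
    by apply: continuous_compact => //; exact: segment_compact.
  by apply: open_closedC; exact: open_interior.
have xK : (~` K) (F x).
  by move=> [y [_ yU] /Finj yx]; apply: yU; rewrite yx; exact: xU.
have nK : nbhs (F x) (~` K).
  by apply: open_nbhs_nbhs; split => //; exact: closed_openC.
near=> t => y Fy.
have tz : t <= F z by move: y Fy; near: t.
have tK : (~` K) t by near: t.
(* The arc attains the value [t], and by injectivity only at [y]. So [y] is on the arc, and [y]
   outside [U] would put [t] in [K]. *)
have [] := @arc_IVT R X F gamma t gammaC FC.
  by rewrite g0 g1 tz andbT -Fy Fmin.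
move=> c c01 Fc; have yc : gamma c = y by apply: Finj; rewrite Fc Fy.
apply: (@interior_subset _ U); apply: contrapT => yU; apply: tK.
by exists y => //; split => //; exists c.
Unshelve. all: by end_near. Qed.

Lemma arcwise_connected_homeomorphic_range (R : realType) (X : topologicalType)
    (F : X -> R) (a : X) (J : set R) :
  arcwise_connected R X -> continuous F -> injective F ->
  (forall y, F a <= F y) -> range F = J ->
  homeomorphic X (set_type J).
Proof.
move=> hX FC Finj Fmin rF.
have FJ x : F x \in J by apply/mem_set; rewrite -rF; exists x.
pose f x : set_type J := SigSub (FJ x).
have gP (t : set_type J) : exists x, F x = set_val t.
  have : range F (set_val t) by rewrite rF; exact: set_valP.
  by case=> x _ <-; exists x.
pose g t := projT1 (cid (gP t)).
have gE t : F (g t) = set_val t by exact: projT2 (cid (gP t)).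
exists f, g; split.
- by move=> x; apply: Finj; rewrite gE.
- by move=> t; apply: val_inj; rewrite /= gE.
- exact: continuous_comp_initial.
- move=> t U gU.
  have := arcwise_connected_inverse_near _ _ _ _ hX FC Finj Fmin _ _ gU.
  rewrite gE => tU.
  have := @initial_continuous _ _ (set_val : set_type J -> R) t _ tU.
  by apply: (@filterS _ (nbhs t)) => s; apply; exact: gE.
Qed.

Lemma arcwise_connected_Jordan_arc (R : realType) (X : topologicalType)
    (F : X -> R) (a b : X) :
  arcwise_connected R X -> continuous F -> injective F ->
  F a = 0 -> (forall y, 0 <= F y) -> a <> b ->
  Jordan_arc R X.
Proof.
move=> hX FC Finj Fa F0 ab.
(* The second point makes the supremum [M] below positive, so division by [M] is legitimate. *)
have Fb : 0 < F b.
  rewrite lt_neqAle F0 andbT; apply/eqP => b0; apply: ab; apply: Finj.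
  by rewrite Fa.
(* An arc from [a] to [y] shows that the range contains all of [[0, F y]]. *)
have ivt y v : 0 <= v <= F y -> exists x, F x = v.
  have [gamma [gammaC g0 g1]] := hX a y => hv.
  have [|c _ <-] := @arc_IVT R X F gamma v gammaC FC; last by exists (gamma c).
  by rewrite g0 g1 Fa.
have [bnd|unb] := pselect (has_ubound (range F)); last first.
  right; apply: (@arcwise_connected_homeomorphic_range R X F a) => //.
    by move=> y; rewrite Fa.
  apply/seteqP; split => [_ [x _ <-]|v]; rewrite /= in_itv/= andbT // => v0.
  have [y vy] : exists y, v <= F y.
    apply: contrapT => hv; apply: unb; exists v => _ [x _ <-].
    by apply: ltW; rewrite ltNge; apply/negP => vx; apply: hv; exists x.
  by have [|x <-] := ivt y v; [rewrite v0 vy|exists x].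
have sF : has_sup (range F) by split => //; exists (F a), a.
set M := sup (range F).
have FM x : F x <= M by apply: ub_le_sup => //; exists x.
have M0 : 0 < M by exact: lt_le_trans (FM b).
have Mne : M != 0 by rewrite gt_eqF.
have [[m Fm]|hM] := pselect (exists m, F m = M).
  left; apply: (@arcwise_connected_homeomorphic_range R X (fun x => F x / M) a).
  - exact: hX.
  - by move=> x; apply: cvgM; [exact: FC|exact: cvg_cst].
  - by move=> x y /(mulIf (invr_neq0 Mne)) /Finj.
  - by move=> y; rewrite Fa mul0r divr_ge0 // ltW.
  - apply/seteqP; split => [_ [x _ <-]|v]; rewrite /= in_itv/=.
      by rewrite divr_ge0 ?(ltW M0)//= ler_pdivrMr// mul1r.
    move=> /andP[v0 v1].
    have [|x Fx] := ivt m (v * M); last by exists x => //; rewrite Fx mulfK.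
    by rewrite Fm mulr_ge0 ?(ltW M0)//= ler_piMl ?(ltW M0).
have FltM x : 0 < M - F x.
  rewrite subr_gt0 lt_neqAle FM andbT; apply/eqP => xM.
  by apply: hM; exists x.
have FneM x : M - F x != 0 by rewrite gt_eqF.
right.
apply: (@arcwise_connected_homeomorphic_range R X (fun x => F x / (M - F x)) a).
- exact: hX.
- move=> x; apply: cvgM; first exact: FC.
  apply: cvgV; first exact: FneM.
  by apply: cvgB; [exact: cvg_cst|exact: FC].
(* Adding [F x * F y] to both sides of the cross-multiplied equation gives [F x * M = F y * M]. *)
- move=> x y /eqP; rewrite eqr_div// => /eqP e; apply: Finj.
  apply: (mulIf Mne).
  have -> : F x * M = F x * (M - F y) + F x * F y by ring.
  by rewrite e; ring.
- by move=> y; rewrite Fa mul0r divr_ge0 // ltW.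
- apply/seteqP; split => [_ [x _ <-]|v]; rewrite /= in_itv/= andbT.
    by rewrite divr_ge0 // ltW.
  move=> v0; have v1 : 0 < 1 + v by lra.
  (* [v * M / (1 + v)] solves [t / (M - t) = v]; being below the supremum, it is exceeded by a value
     of [F] and hence attained. *)
  have vM : v * M / (1 + v) < M by rewrite ltr_pdivrMr// mulrDr mulr1; lra.
  have [_ [y _ <-] yv] := sup_gt sF.1 vM.
  have [|x Fx] := ivt y (v * M / (1 + v)).
    by rewrite (ltW yv) andbT divr_ge0 ?(ltW v1)// mulr_ge0 // ltW.
  exists x => //; rewrite Fx.
  have -> : M - v * M / (1 + v) = M / (1 + v) by field; lra.
  by field; apply/andP; split; rewrite ?gt_eqF.
Qed.

Lemma mdist_continuous (R : realType) (X : metricType R) (a : X) :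
  continuous (fun x : X => mdist x a).
Proof.
move=> x; apply/cvgrPdist_lt => e e0; near=> y.
have : ball x e y by near: y; exact: nbhsx_ballx.
rewrite ballEmdist/=; apply: le_lt_trans.
have := metric_triangle x y a; have := metric_triangle y x a.
rewrite (metric_sym y x) ler_norml => h1 h2; apply/andP; split; lra.
Unshelve. all: by end_near. Qed.

Lemma dim1_eq1_generator (R : realType) (X : metricType R) (u v : X) :
  u <> v -> dim1 X = 1%E ->
  exists a : X, injective (fun x : X => mdist x a).
Proof.
move=> uv hdim.
(* Comparing the infimum with 2 yields an actual generator with fewer than two points, without first
   showing that the infimum is attained. *)
have /ereal_inf_lt[_ [S Sgen <-]] : (dim1 X < 2%:E)%E.
  by rewrite hdim lte_fin ltr1n.
rewrite /counting; case: asboolP => // Sfin.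
rewrite lte_fin ltr_nat => card.
(* Separating [u] from [v] forces [S] to be nonempty; a point of [S] other than [a] would give it
   two elements. *)
have [a Sa _] := Sgen _ _ uv.
exists a => x y /= xy; apply: contrapT => /Sgen[w Sw]; apply.
suff -> : w = a by [].
apply: contrapT => /eqP wa; move: card; apply/negP; rewrite -leqNgt.
have <- : #|` [fset w; a]%fset| = 2%N by rewrite cardfs2 wa.
apply: fsubset_leq_card; apply/fsubsetP => z.
by rewrite !inE in_fset_set// => /orP[]/eqP ->; exact: mem_set.
Qed.

Theorem theorem4p4 (R : realType) (X : metricType R)
  (hconn : arcwise_connected R X)
  (hthree : exists x y z : X, [/\ x <> y, y <> z & x <> z])
  (hdim : dim1 X = 1%E) :
  Jordan_arc R X.
Proof.
have [x [y [_ [xy _ _]]]] := hthree.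
have [a ainj] := dim1_eq1_generator _ _ _ _ xy hdim.
have [b ab] : exists b, a <> b.
  by have [ax|] := pselect (a = x); [exists y; rewrite ax|exists x].
apply: (@arcwise_connected_Jordan_arc R X (fun x => mdist x a) a b) => //.
- exact: mdist_continuous.
- exact: mdistxx.
- by move=> z; exact: mdist_ge0.
Qed.
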